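(* Let $L$ and $L'$ be languages (value sets $\mathbf V,\mathbf V'$) satisfying the Alpha Postulate, suppose every $v\in\mathbf V$ equals $[\![P]\!]_L$ for some closed $L$-term $P$, and let $T$ be a compositional translation from $L$ into $L'$ that respects $\precsim$, where $\precsim$ is a preorder (on a set containing $\mathbf V\cup\mathbf V'$) that respects $\equiv^\alpha_L$ and $\equiv^\alpha_{L'}$. Then $T$ is valid up to $\precsim$.
   Context: Fix a sufficiently large set $\mathcal V$ of variables. A language $L$ has a set $\mathbb T_L$ of expressions built inductively from variables by operators and possibly other (possibly binding) constructs; $\mathrm{fv}(E)$ denotes free variables; closed terms have none, and for a closed term $P$ the value $[\![P]\!]_L(\rho)$ is independent of $\rho$ and written $[\![P]\!]_L$. Semantics: $[\![\cdot]\!]_L:\mathbb T_L\to((\mathcal V\to\mathbf V)\to\mathbf V)$ with $[\![X]\!]_L(\rho)=\rho(X)$, $[\![E]\!]_L(\rho)$ depending only on $\rho|_{\mathrm{fv}(E)}$, and (standing assumption) for all $E$, substitutions $\sigma$, valuations $\rho$ there is $F=_\alpha E$ with $[\![E[\sigma]]\!]_L(\rho)=[\![F]\!]_L([\![\sigma]\!]_L(\rho))$, where $[\![\sigma]\!]_L(\rho)(X)=[\![\sigma(X)]\!]_L(\rho)$. Substitutions act by capture-avoiding replacement; $=_\alpha$ is $\alpha$-convertibility. $v\equiv^\alpha_L w$ iff there are $E=_\alpha F$ and $\zeta$ with $[\![E]\!]_L(\zeta)=v$, $[\![F]\!]_L(\zeta)=w$; Alpha Postulate: $\equiv^\alpha_L$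 is an equivalence; $\precsim$ respects $\equiv^\alpha_L$ if $\equiv^\alpha_L\subseteq\,\precsim$. A translation $T:\mathbb T_L\to\mathbb T_{L'}$ is compositional if $T(E[\sigma])=_\alpha T(E)[T\circ\sigma]$ for all $E$ and $\sigma:\mathrm{fv}(E)\to\mathbb T_L$, $E=_\alpha F$ implies $T(E)=_\alpha T(F)$, and $T(X)=X$. $T$ respects $\precsim$ if for every $v\in\mathbf V$ there is $v'\in\mathbf V'$ with $v'\precsim v$, and $[\![T(P)]\!]_{L'}(\eta)\precsim[\![P]\!]_L$ for all closed $L$-terms $P$ and all valuations $\eta:\mathcal V\to\mathbf U$, where $\mathbf U=\{v'\in\mathbf V'\mid\exists v\in\mathbf V.\ v'\precsim v\}$. A semantic translation is $R\subseteq\mathbf V'\times\mathbf V$ with every $v\in\mathbf V$ having some $v'Rv$; $T$ is correct w.r.t. $R$ if $[\![T(E)]\!]_{L'}(\eta)\,R\,[\![E]\!]_L(\rho)$ whenever $\eta(X)R\rho(X)$ for all $X$; $T$ is valid up to $\precsim$ if correct w.r.t. some semantic translation $R\subseteq\,\precsim$. *)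

(* Defs.v *)
From Stdlib Require Import RelationClasses.
From mathcomp Require Import all_boot.

Set Implicit Arguments.
Unset Strict Implicit.
Unset Printing Implicit Defensive.

(* A construct [c] takes a family of arguments indexed by [arg c], possibly
   infinite, and binds a family of variables indexed by [slot c];
   [scope c i s] says that the variable at slot [s] is bound in argument [i].
   An operator is a construct without slots; a recursion construct <x | S> has
   one slot and one argument per equation of S, all slots scoping over all
   arguments. *)
Record signature := Signature {
  con : Type;
  arg : con -> Type;
  slot : con -> Type;
  scope : forall c, arg c -> slot c -> Prop
}.
Arguments scope {s} c i s0.

Section Syntax.
Variables (V : Type) (S : signature).

(* Slots with a common scope carry distinct variables; a variable may be
   reused at slots whose scopes are disjoint. *)
Record binders (c : con S) := Binders {
  binder :> slot c -> V;
  binder_inj : forall i s t,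
    scope c i s -> scope c i t -> binder s = binder t -> s = t
}.

Inductive expr : Type :=
| Var of V
| Con (c : con S) (b : binders c) (args : arg c -> expr).

Definition bound (c : con S) (b : binders c) (i : arg c) (X : V) : Prop :=
  exists2 s, scope c i s & b s = X.

Fixpoint fv (E : expr) (X : V) : Prop :=
  match E with
  | Var Y => X = Y
  | Con c b args => exists2 i, fv (args i) X & ~ bound b i X
  end.

Definition closed (E : expr) : Prop := forall X, ~ fv E X.

(* If the binders [b] of [Con b args] are renamed into [b'], then replacing
   the free variables of [Con b args] as prescribed by [sigma] captures
   nothing. *)
Definition no_capture (sigma : V -> expr) (c : con S) (b : binders c)
    (args : arg c -> expr) (b' : binders c) : Prop :=
  forall i s Y, scope c i s -> fv (args i) Y -> ~ bound b i Y ->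
    ~ fv (sigma Y) (b' s).

(* [tau i] is [sigma] below the binders of argument [i], where these binders
   are renamed from [b] into [b']. *)
Definition under (sigma : V -> expr) (c : con S) (b b' : binders c)
    (tau : arg c -> V -> expr) : Prop :=
  (forall i s, scope c i s -> tau i (b s) = Var (b' s)) /\
  (forall i X, ~ bound b i X -> tau i X = sigma X).

(* [replaced sigma E F]: F is a result of the capture-avoiding replacement in
   E of each free X by [sigma X]. This is a relation because the new names of
   bound variables are arbitrary; binders are kept when they capture nothing. *)
Inductive replaced : (V -> expr) -> expr -> expr -> Prop :=
| replaced_var sigma X : replaced sigma (Var X) (sigma X)
| replaced_con sigma (c : con S) (b b' : binders c) args args' tau :
    no_capture sigma b args b' ->
    (no_capture sigma b args b -> b' =1 b) ->
    under sigma b b' tau ->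
    (forall i, replaced (tau i) (args i) (args' i)) ->
    replaced sigma (Con b args) (Con b' args').

(* The least congruence containing the capture-avoiding renamings of the
   variables bound by a construct. *)
Inductive alpha : expr -> expr -> Prop :=
| alpha_refl E : alpha E E
| alpha_sym E F : alpha E F -> alpha F E
| alpha_trans E F G : alpha E F -> alpha F G -> alpha E G
| alpha_con (c : con S) (b : binders c) args args' :
    (forall i, alpha (args i) (args' i)) -> alpha (Con b args) (Con b args')
| alpha_rename (c : con S) (b b' : binders c) args args' tau :
    no_capture Var b args b' ->
    under Var b b' tau ->
    (forall i, replaced (tau i) (args i) (args' i)) ->
    alpha (Con b args) (Con b' args').

Definition substitution := V -> option expr.

Definition dom (sigma : substitution) (X : V) : Prop := sigma X <> None.

(* Variables outside the domain are left unchanged. *)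
Definition app (sigma : substitution) (X : V) : expr := odflt (Var X) (sigma X).

End Syntax.

Arguments Var {V S}.

Definition small (V A : Type) : Prop :=
  (exists f : A -> V, injective f) /\ ~ (exists g : V -> A, injective g).

(* "Sufficiently large": the cardinality of V is infinite, regular, and exceeds
   the number of arguments and of slots of each construct. If these numbers are
   all finite, then any countably infinite V qualifies. *)
Definition sufficiently_large (V : Type) (S : signature) : Prop :=
  [/\ exists f : nat -> V, injective f,
      forall (I : Type) (A : I -> Type),
        small V I -> (forall i, small V (A i)) -> small V {i : I & A i},
      forall c : con S, small V (arg c)
    & forall c : con S, small V (slot c)].

(* The values of all languages under consideration live in a common type D. *)
Record language (V D : Type) := Language {
  sig_of : signature;
  is_value : D -> Prop;
  value := {d : D | is_value d};
  (* E[sigma], with the names of renamed bound variables chosen by the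
     language *)
  esubst : expr V sig_of -> substitution V sig_of -> expr V sig_of;
  esubstP : forall E sigma, replaced (app sigma) E (esubst E sigma);
  sem : expr V sig_of -> (V -> value) -> value;
  sem_var : forall X rho, sem (Var X) rho = rho X;
  sem_fv : forall E rho rho',
    (forall X, fv E X -> rho X = rho' X) -> sem E rho = sem E rho';
  sem_subst : forall E sigma rho, exists2 F, alpha F E &
    sem (esubst E sigma) rho = sem F (fun X => sem (app sigma X) rho)
}.

Definition term (V D : Type) (L : language V D) := expr V (sig_of L).

(* P is closed with value v; quantifying over [rho] is needed because there is
   no valuation if L has no values. *)
Definition denotes (V D : Type) (L : language V D) (P : term L) (v : value L) :
  Prop := closed P /\ forall rho, sem P rho = v.

Definition alpha_value (V D : Type) (L : language V D) (v w : value L) : Prop :=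
  exists E F : term L, exists zeta : V -> value L,
    [/\ alpha E F, sem E zeta = v & sem F zeta = w].

Definition alpha_postulate (V D : Type) (L : language V D) : Prop :=
  Equivalence (@alpha_value V D L).

Definition respects_alpha (V D : Type) (le : D -> D -> Prop)
    (L : language V D) : Prop :=
  forall v w : value L, alpha_value v w -> le (sval v) (sval w).

Section Translations.
Variables (V D : Type) (L L' : language V D) (le : D -> D -> Prop).
Variable T : term L -> term L'.

Definition compositional : Prop :=
  [/\ forall (E : term L) (sigma : substitution V (sig_of L)),
        (forall X, dom sigma X <-> fv E X) ->
        alpha (T (esubst E sigma)) (esubst (T E) (fun X => omap T (sigma X))),
      forall E F : term L, alpha E F -> alpha (T E) (T F)
    & forall X : V, T (Var X) = Var X].

Definition in_U (v' : value L') : Prop :=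
  exists v : value L, le (sval v') (sval v).

Definition respects : Prop :=
  (forall v : value L, exists v' : value L', le (sval v') (sval v)) /\
  (forall (P : term L) (v : value L), denotes P v ->
     forall eta : V -> value L', (forall X, in_U (eta X)) ->
     le (sval (sem (T P) eta)) (sval v)).

Definition semantic_translation (R : value L' -> value L -> Prop) : Prop :=
  forall v, exists v', R v' v.

Definition correct (R : value L' -> value L -> Prop) : Prop :=
  forall (E : term L) (eta : V -> value L') (rho : V -> value L),
    (forall X, R (eta X) (rho X)) -> R (sem (T E) eta) (sem E rho).

Definition valid_up_to : Prop :=
  exists R : value L' -> value L -> Prop,
    [/\ semantic_translation R,
        forall v' v, R v' v -> le (sval v') (sval v)
      & correct R].

End Translations.

(* Main.v *)
(* Relate v' to v when, for some closed P and some valuation eta into U, v is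
   alpha-equivalent to the value of P and v' to that of T P under eta. For a
   closed E correctness is immediate. For an open E, substitute the closed terms
   P_X behind the values of its free variables X. Compositionality then
   yields the claim, provided that the valuations eta_X behind the different
   T P_X can be replaced by a single one. They can: for open E the free
   variables of T E are among those of E, and if T P has a free variable for
   some closed P, then T E has at most one free variable for every open E.

   The argument needs alpha-equivalence of values to be preserved by contexts,
   also with infinitely many free variables. Alpha-convertibility itself is
   handled through a de Bruijn-style denotation that characterises it. *)
Require Import Defs.
From Stdlib Require Import RelationClasses.
From Stdlib Require Import Classical ClassicalEpsilon FunctionalExtensionality.
From Stdlib Require Import ProofIrrelevance Eqdep.
From mathcomp Require Import all_boot.

Set Implicit Arguments.
Unset Strict Implicit.
Unset Printing Implicit Defensive.

(** * Choice and extension of functions *)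

Lemma fun_choice (A B : Type) (P : A -> B -> Prop) :
  (forall a, exists b, P a b) -> exists f, forall a, P a (f a).
Proof.
move=> ex; pose T a := constructive_indefinite_description _ (ex a).
by exists (fun a => proj1_sig (T a)) => a; apply: (proj2_sig (T a)).
Qed.

(** Outside the image of [f] the extension falls back on [d]. The second clause bounds the range of
    [g]; it is used to see that a renaming moves variables only to fresh names. *)
Lemma extend_along (A B C : Type) (f : A -> B) (k : A -> C) (d : B -> C) :
  injective f ->
  exists g, (forall a, g (f a) = k a) /\
            (forall b, g b = d b \/ exists a, g b = k a).
Proof.
move=> finj.
have [b | g gP] := @fun_choice B C (fun b c =>
    (forall a, f a = b -> c = k a) /\ (c = d b \/ exists a, c = k a)).
  have [[a fa] | no] := classic (exists a, f a = b).
    by exists (k a); split; [move=> a'; rewrite -fa => /finj -> | right; exists a].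
  by exists (d b); split; [move=> a fa; case: no; exists a | left].
by exists g; split=> [a | b]; [have [gk _] := gP (f a); apply: gk | case: (gP b)].
Qed.

(** * Small sets of variables and fresh names *)

Section Cardinality.
Variables (V : Type) (S : signature).
Hypothesis large : sufficiently_large V S.

Lemma small_inj (I J : Type) (f : J -> I) : injective f -> small V I -> small V J.
Proof.
move=> finj [[g ginj] noinj]; split.
  by exists (g \o f); apply: inj_comp.
by move=> [h hinj]; apply: noinj; exists (f \o h); apply: inj_comp.
Qed.

Lemma sval_injective (A : Type) (P : A -> Prop) : injective (@sval A P).
Proof.
move=> [x px] [y py] /= exy; subst y.
by rewrite (proof_irrelevance _ px py).
Qed.

Lemma small_cover (I : Type) (f : I -> V) (W : V -> Prop) :
  (forall X, W X -> exists i, f i = X) -> small V I -> small V {X | W X}.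
Proof.
move=> cover smallI.
have [g gK] := fun_choice (fun x : {X | W X} => cover _ (svalP x)).
apply: (@small_inj I _ g) => // x y exy.
by apply: sval_injective; rewrite -!gK exy.
Qed.

(** Regularity bounds the disjoint union of the sets, which covers their union. *)
Lemma small_bigcup (I : Type) (W : I -> V -> Prop) :
  small V I -> (forall i, small V {X | W i X}) ->
  small V {X | exists i, W i X}.
Proof.
move=> smallI smallW; have [_ regular _ _] := large.
apply: (@small_cover {i : I & {X | W i X}} (fun u => sval (projT2 u))).
  by move=> X [i WX]; exists (existT _ i (exist _ X WX)).
exact: regular.
Qed.

Lemma small_bool : small V bool.
Proof.
have [[f finj] _ _ _] := large; split.
  by exists (f \o nat_of_bool); apply: inj_comp => // -[] [].
move=> [g ginj].
case E0: (g (f 0)); case E1: (g (f 1)); case E2: (g (f 2));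
  by [ have := finj _ _ (ginj _ _ (etrans E0 (esym E1)))
     | have := finj _ _ (ginj _ _ (etrans E0 (esym E2)))
     | have := finj _ _ (ginj _ _ (etrans E1 (esym E2))) ].
Qed.

Lemma small_setU (W1 W2 : V -> Prop) :
  small V {X | W1 X} -> small V {X | W2 X} -> small V {X | W1 X \/ W2 X}.
Proof.
move=> small1 small2.
have := @small_bigcup bool (fun k => if k then W1 else W2) small_bool.
case/(_ (fun k => if k return small V {X | (if k then W1 else W2) X}
                  then small1 else small2)) => _ noinj.
split; first by exists sval; apply: sval_injective.
move=> [g ginj]; apply: noinj.
have W X : W1 X \/ W2 X -> exists k : bool, (if k then W1 else W2) X.
  by case=> ?; [exists true | exists false].
exists (fun X => exist _ (sval (g X)) (W _ (svalP (g X)))) => X Y /(congr1 sval) /=.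
by move/sval_injective/ginj.
Qed.

(* If the complement of W were small as well, V would be a union of two small
   sets; so V embeds into that complement. *)
Lemma fresh_inj (I : Type) (W : V -> Prop) :
  small V I -> small V {X | W X} ->
  exists2 f : I -> V, injective f & forall i, ~ W (f i).
Proof.
move=> [[f finj] _] smallW.
have : exists g : V -> {X | ~ W X}, injective g.
  apply: NNPP => noinj.
  have smallC : small V {X | ~ W X}.
    by split=> //; exists sval; apply: sval_injective.
  have [_ []] := small_setU smallW smallC.
  exists (fun X => exist _ X (classic (W X))) => X Y.
  by move/(congr1 sval).
move=> [g ginj]; exists (sval \o g \o f).
  by apply: inj_comp => //; apply: inj_comp => //; apply: sval_injective.
by move=> i /=; apply: (svalP (g (f i))).
Qed.

Fixpoint bv (E : expr V S) (X : V) : Prop :=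
  match E with
  | Var _ => False
  | Con c b args => (exists s, b s = X) \/ exists i, bv (args i) X
  end.

Lemma small_bv (E : expr V S) : small V {X | bv E X}.
Proof.
have [_ _ small_arg small_slot] := large.
elim: E => [Y | c b args IH] /=.
  apply: (@small_cover bool (fun _ => Y)) => //; exact: small_bool.
apply: small_setU; last exact: small_bigcup.
by apply: (@small_cover (slot c) b).
Qed.

Lemma small_fv (E : expr V S) : small V {X | fv E X}.
Proof.
have [_ _ small_arg small_slot] := large.
elim: E => [Y | c b args IH] /=.
  apply: (@small_cover bool (fun _ => Y)); last exact: small_bool.
  by move=> X ->; exists true.
have [[f finj] _ ] := small_bigcup (small_arg c) IH.
apply: (@small_inj {X | exists i, fv (args i) X} _
  (fun x => exist _ (sval x) (let: ex_intro2 i h _ := svalP x in ex_intro _ i h))).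
  by move=> x y /(congr1 sval) /= /sval_injective.
exact: small_bigcup.
Qed.

End Cardinality.

(** * De Bruijn-level denotation of expressions *)

Section Denotation.
Variables (V : Type) (S : signature).

(** In a leaf [Level n s], [n] is the depth of the binding construct and [s] its slot. No binder
    name remains, so that alpha-convertible expressions can have equal trees. *)
Inductive tree : Type :=
| Free of V
| Level (n : nat) (c : con S) (s : slot c)
| Node (c : con S) of (arg c -> tree).

Lemma Level_inj (n : nat) (c : con S) (s t : slot c) :
  Level n s = Level n t -> s = t.
Proof. by case=> eq_st; apply: inj_pair2 eq_st. Qed.

Lemma Node_inj (c : con S) (a a' : arg c -> tree) : Node a = Node a' -> a = a'.
Proof. by case=> eq_a; apply: inj_pair2 eq_a. Qed.

(** The slot is picked by classical choice; [binder_inj] makes it unique. *)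
Definition slot_of (c : con S) (b : binders V c) (i : arg c) (X : V) :
    option (slot c) :=
  match excluded_middle_informative (exists s, scope c i s /\ b s = X) with
  | left p => Some (proj1_sig (constructive_indefinite_description _ p))
  | right _ => None
  end.

Lemma slot_ofP (c : con S) (b : binders V c) (i : arg c) (X : V) :
  (exists s, [/\ scope c i s, b s = X & slot_of b i X = Some s]) \/
  (~ bound b i X /\ slot_of b i X = None).
Proof.
rewrite /slot_of; case: excluded_middle_informative => [p | np].
  by case: constructive_indefinite_description => s [si bs] /=; left; exists s.
by right; split=> // -[s si bs]; apply: np; exists s.
Qed.

Lemma slot_of_binder (c : con S) (b : binders V c) (i : arg c) (s : slot c) :
  scope c i s -> slot_of b i (b s) = Some s.
Proof.
move=> si; case: (slot_ofP b i (b s)) => [[t [ti bt ->]] | [nb _]].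
  by rewrite (binder_inj ti si bt).
by case: nb; exists s.
Qed.

Lemma slot_of_free (c : con S) (b : binders V c) (i : arg c) (X : V) :
  ~ bound b i X -> slot_of b i X = None.
Proof. by case: (slot_ofP b i X) => [[s [si bs _]] []|[]//]; exists s. Qed.

Definition env := V -> nat -> tree.

Definition extend (e : env) (c : con S) (b : binders V c) (n : nat) (i : arg c) :
    env :=
  fun X => if slot_of b i X is Some s then fun=> Level n s else e X.

(* De Bruijn levels: the value of a variable may depend on the depth at which
   it is used, so that no shifting is needed below binders. *)
Fixpoint den (E : expr V S) (e : env) (n : nat) : tree :=
  match E with
  | Var X => e X n
  | Con c b args => Node (fun i => den (args i) (extend e b n i) n.+1)
  end.

Lemma eq_den (E : expr V S) (e e' : env) (n : nat) :
  (forall X, fv E X -> e X =1 e' X) -> den E e n = den E e' n.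
Proof.
elim: E e e' n => [X | c b args IH] e e' n eq_e /=; first exact: eq_e.
congr Node; apply: functional_extensionality => i; apply: IH => X fvX.
rewrite /extend; case: (slot_ofP b i X) => [[s [_ _ ->]] // | [nb ->]].
by apply: eq_e; exists i.
Qed.

(** The inductive step shared by [den_replaced] and the renaming case of [alpha_den]. By
    [no_capture], the variables of the inserted [sigma X] are not bound by [b'], so extending the
    environment does not affect them. *)
Lemma den_under (sigma : V -> expr V S) (c : con S) (b b' : binders V c)
    (args args' : arg c -> expr V S) (tau : arg c -> V -> expr V S)
    (e : env) (n : nat) :
  no_capture sigma b args b' -> under sigma b b' tau ->
  (forall i e n, den (args' i) e n = den (args i) (fun X => den (tau i X) e) n) ->
  den (Con b' args') e n = den (Con b args) (fun X => den (sigma X) e) n.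
Proof.
move=> nocap [tau_b tau_f] IH /=.
congr Node; apply: functional_extensionality => i; rewrite IH.
apply: eq_den => X fvX m; rewrite {2}/extend.
case: (slot_ofP b i X) => [[s [si <- ->]] | [nb ->]].
  by rewrite tau_b //= /extend slot_of_binder.
rewrite tau_f //; apply: eq_den => Y fvY k; rewrite /extend.
case: (slot_ofP b' i Y) => [[s [si bs _]] | [_ -> //]].
by case: (nocap i s X si fvX nb); rewrite bs.
Qed.

Lemma den_replaced (sigma : V -> expr V S) (E F : expr V S) (e : env) (n : nat) :
  replaced sigma E F -> den F e n = den E (fun X => den (sigma X) e) n.
Proof.
move=> rep; elim: rep e n => {sigma E F} //.
move=> sigma c b b' args args' tau nocap _ und _ IH e n.
exact: (den_under _ _ nocap und IH).
Qed.

Lemma alpha_den (E F : expr V S) (e : env) (n : nat) :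
  alpha E F -> den E e n = den F e n.
Proof.
move=> a; elim: a e n => {E F} //.
- by move=> E F G _ IH1 _ IH2 e n; rewrite IH1.
- move=> c b args args' _ IH e n /=; congr Node.
  by apply: functional_extensionality => i.
- move=> c b b' args args' tau nocap und rep e n.
  rewrite (den_under _ _ nocap und (fun i e n => den_replaced e n (rep i))).
  exact: eq_den.
Qed.

Fixpoint free (t : tree) (X : V) : Prop :=
  match t with
  | Free Y => X = Y
  | Level _ _ _ => False
  | Node c args => exists i, free (args i) X
  end.

(** The relation [p] is a parameter so that the induction can pass below a binder, where pairs with
    a bound first component are discarded. *)
Lemma free_den (E : expr V S) (e : env) (n : nat) (p : V -> V -> Prop) (Y : V) :
  (forall X m, free (e X m) Y <-> p X Y) ->
  free (den E e n) Y <-> exists2 X, fv E X & p X Y.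
Proof.
elim: E e n p => [X | c b args IH] e n p freeE /=.
  by rewrite freeE; split=> [pXY | [_ -> //]]; exists X.
have IHi i := IH i (extend e b n i) n.+1 (fun X Y => ~ bound b i X /\ p X Y).
have {}IHi i : free (den (args i) (extend e b n i) n.+1) Y <->
    exists2 X, fv (args i) X & ~ bound b i X /\ p X Y.
  apply: IHi => X m; rewrite /extend.
  case: (slot_ofP b i X) => [[s [si bs ->]] | [nb ->]] /=.
    by split=> // -[[]]; exists s.
  by rewrite freeE; split=> [|[]].
split=> [[i /IHi [X fvX [nb pXY]]] | [X [i fvX nb] pXY]].
  by exists X => //; exists i.
by exists i; apply/IHi; exists X.
Qed.

Definition env0 : env := fun X _ => Free X.

Lemma free_den0 (E : expr V S) (n : nat) (X : V) :
  free (den E env0 n) X <-> fv E X.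
Proof.
rewrite (@free_den E env0 n (fun Y Z => Z = Y)) //.
by split=> [[_ fvX ->] // | fvX]; exists X.
Qed.

Lemma alpha_fv (E F : expr V S) (X : V) : alpha E F -> fv E X <-> fv F X.
Proof.
by move=> a; rewrite -(free_den0 E 0) -(free_den0 F 0) (alpha_den _ _ a).
Qed.

Lemma replaced_fv (sigma : V -> expr V S) (E F : expr V S) (Y : V) :
  replaced sigma E F -> fv F Y <-> exists2 X, fv E X & fv (sigma X) Y.
Proof.
move=> rep; rewrite -(free_den0 F 0) (den_replaced _ _ rep).
apply: (@free_den E (fun X => den (sigma X) env0) 0 (fun X => fv (sigma X))) => X m.
exact: free_den0.
Qed.

(** Conditions under which equal trees force alpha-convertibility: variables denote distinct leaves,
    so none is mistaken for a construct, and levels in use stay below [n], so that level [n] is new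
    for the next construct. *)
Definition separating (e : env) (n : nat) : Prop :=
  (forall X m m', e X m = e X m' /\
     match e X m with Free _ => True | Level k _ _ => k < n | Node _ _ => False end)
  /\ (forall X Y m m', e X m = e Y m' -> X = Y).

Lemma separating_extend (e : env) (c : con S) (b : binders V c) (n : nat)
    (i : arg c) :
  separating e n -> separating (extend e b n i) n.+1.
Proof.
move=> [atom inj]; split=> [X m m' | X Y m m']; rewrite /extend.
  case: (slot_ofP b i X) => [[s [_ _ ->]] | [_ ->]] //.
  have [eX lt] := atom X m m'; split=> //.
  by case: (e X m) lt => // k d s /ltnW.
case: (slot_ofP b i X) => [[s [_ <- ->]] | [_ ->]];
  case: (slot_ofP b i Y) => [[t [_ <- ->]] | [_ ->]].
- by move/Level_inj=> ->.
- by move=> eXY; have [_] := atom Y m' m'; rewrite -eXY ltnn.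
- by move=> eXY; have [_] := atom X m m; rewrite eXY ltnn.
- exact: inj.
Qed.

(** * Equal denotations imply alpha-convertibility *)

Section Completeness.
Hypothesis large : sufficiently_large V S.
(** A language supplies this through [esubst]. *)
Hypothesis replaced_total :
  forall (sigma : V -> expr V S) E, exists F, replaced sigma E F.

Definition rebind (c : con S) (b b' : binders V c) (i : arg c) (X : V) :
    expr V S :=
  if slot_of b i X is Some s then Var (b' s) else Var X.

Lemma under_rebind (c : con S) (b b' : binders V c) :
  under Var b b' (rebind b b').
Proof.
split=> [i s si | i X nb]; rewrite /rebind.
  by rewrite slot_of_binder.
by rewrite slot_of_free.
Qed.

Lemma fresh_rebind (c : con S) (b b' : binders V c) (args : arg c -> expr V S) :
  (forall s i, ~ fv (args i) (b' s)) ->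
  exists args', [/\ alpha (Con b args) (Con b' args') &
    forall i e n, den (args' i) e n = den (args i) (fun X => den (rebind b b' i X) e) n].
Proof.
move=> fresh.
have [args' rep] : exists args', forall i, replaced (rebind b b' i) (args i) (args' i).
  exact: (@fun_choice _ _ (fun i F => replaced (rebind b b' i) (args i) F)).
exists args'; split=> [|i e n]; last exact: den_replaced.
apply: (alpha_rename _ (under_rebind b b') rep) => i s Y si fvY _ /= eY.
by apply: (fresh s i); rewrite eY.
Qed.

(** The induction is on the common tree, because the arguments of both expressions change when their
    binders are renamed. *)
Lemma den_alpha_separating (t : tree) (E F : expr V S) (e : env) (n : nat) :
  separating e n -> den E e n = t -> den F e n = t -> alpha E F.
Proof.
elim: t E F e n => [X | k c s | c a IH] E F e n sep.
1,2: case: E => [Y | c' b args] //= eY; case: F => [Z | c' b args] //= eZ;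
  by case: sep => _ /(_ Y Z n n); rewrite eY eZ => ->; first exact: alpha_refl.
case: E => [Y | c1 b args] /=.
  by move=> eY; case: sep => /(_ Y n n) [_]; rewrite eY.
case: F => [Z | c2 b' args'] /=.
  by move=> _ eZ; case: sep => /(_ Z n n) [_]; rewrite eZ.
move=> e1 e2.
have ec1 : c1 = c by case: e1.
have ec2 : c2 = c by case: e2.
subst c1 c2.
move/Node_inj: e1 => e1; move/Node_inj: e2 => e2.
have [_ _ small_arg small_slot] := large.
have small_args (ar : arg c -> expr V S) : small V {X | exists i, fv (ar i) X}.
  by apply: (small_bigcup large) => // i; apply: (small_fv large).
(* The new binders are fresh for both families of arguments, so both constructs can be renamed to
   the same [b0]. *)
have [f finj fresh] := fresh_inj large (small_slot c)
  (small_setU large (small_args args) (small_args args')).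
pose b0 := @Binders V S c f (fun i s t _ _ h => finj s t h).
have fresh1 s i : ~ fv (args i) (b0 s).
  by move=> fvs; apply: (fresh s); left; exists i.
have fresh2 s i : ~ fv (args' i) (b0 s).
  by move=> fvs; apply: (fresh s); right; exists i.
have [args1 [a1 d1]] := fresh_rebind b fresh1.
have [args2 [a2 d2]] := fresh_rebind b' fresh2.
apply: alpha_trans a1 (alpha_trans _ (alpha_sym a2)).
apply: alpha_con => i.
(* Rebinding to [b0] preserves the tree of each argument, so the induction hypothesis applies to the
   renamed arguments. *)
have rebindE b1 (ar : arg c -> expr V S) : (forall s i, ~ fv (ar i) (b0 s)) ->
    den (ar i) (fun X => den (rebind b1 b0 i X) (extend e b0 n i)) n.+1 =
    den (ar i) (extend e b1 n i) n.+1.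
  move=> fr; apply: eq_den => X fvX m; rewrite {2}/extend /rebind.
  case: (slot_ofP b1 i X) => [[s [si _ ->]] | [nb ->]] /=.
    by rewrite /extend slot_of_binder.
  rewrite /extend; case: (slot_ofP b0 i X) => [[s [_ bs _]] | [_ -> //]].
  by case: (fr s i); rewrite bs.
apply: (IH i _ _ (extend e b0 n i) n.+1); first exact: separating_extend.
- by rewrite d1 rebindE // -e1.
- by rewrite d2 rebindE // -e2.
Qed.

Lemma den_alpha (E F : expr V S) :
  (forall e n, den E e n = den F e n) -> alpha E F.
Proof.
move=> eqd; apply: (@den_alpha_separating (den F env0 0) E F env0 0) => //.
by split=> // X Y m m' [].
Qed.

End Completeness.

(** * Renaming of free variables *)

Definition away (c : con S) (b : binders V c) (i : arg c) (f : V -> V) (X : V) :=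
  if slot_of b i X is Some _ then X else f X.

(** Binders are never changed here; [avoids f (bv E)] is what excludes capture. *)
Fixpoint rename (f : V -> V) (E : expr V S) : expr V S :=
  match E with
  | Var X => Var (f X)
  | Con c b args => Con b (fun i => rename (away b i f) (args i))
  end.

(** A variable left in place cannot be newly captured, so only the moved ones have to miss [W]. *)
Definition avoids (f : V -> V) (W : V -> Prop) : Prop :=
  forall X, f X = X \/ ~ W (f X).

Lemma avoids_away (c : con S) (b : binders V c) (args : arg c -> expr V S)
    (f : V -> V) (i : arg c) :
  avoids f (bv (Con b args)) -> avoids (away b i f) (bv (args i)).
Proof.
move=> av X; rewrite /away; case: slot_of => [_|]; first by left.
case: (av X) => [-> | nbv]; first by left.
by right=> bvX; apply: nbv; right; exists i.
Qed.

Lemma avoids_bound (c : con S) (b : binders V c) (args : arg c -> expr V S)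
    (f : V -> V) (i : arg c) (X : V) :
  avoids f (bv (Con b args)) -> ~ bound b i X -> ~ bound b i (f X).
Proof.
move=> av nb [s si bs]; case: (av X) => [fX | []].
  by apply: nb; exists s; rewrite // -fX.
by left; exists s.
Qed.

Lemma den_rename (f : V -> V) (E : expr V S) (e : env) (n : nat) :
  avoids f (bv E) -> den (rename f E) e n = den E (fun X => e (f X)) n.
Proof.
elim: E f e n => [X // | c b args IH] f e n av /=.
congr Node; apply: functional_extensionality => i.
rewrite IH; last exact: avoids_away av.
apply: eq_den => X _ m; rewrite /extend /away.
case: (slot_ofP b i X) => [[s [si bs eqs]] | [nb ->]]; first by rewrite eqs eqs.
by rewrite slot_of_free //; apply: avoids_bound av nb.
Qed.

Lemma rename_fv (f : V -> V) (E : expr V S) (Y : V) :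
  avoids f (bv E) -> fv (rename f E) Y <-> exists2 X, fv E X & Y = f X.
Proof.
move=> av; rewrite -(free_den0 _ 0) den_rename //.
exact: (@free_den E _ 0 (fun X Z => Z = f X)).
Qed.

(* This is an equality, not just alpha-conversion: binders that capture nothing
   are kept. *)
Lemma replaced_rename (f : V -> V) (sigma : V -> expr V S) (E F : expr V S) :
  avoids f (bv E) -> (forall X, fv E X -> sigma (f X) = Var X) ->
  replaced sigma (rename f E) F -> F = E.
Proof.
elim: E f sigma F => [X | c b args IH] f sigma F av inv rep.
  by inversion rep; subst; apply: inv.
inversion rep as [| sigma' c' b0 b' args0 args' tau nocap keep und reps].
subst sigma' c' F.
repeat match goal with H : existT _ _ _ = existT _ _ _ |- _ =>
  apply inj_pair2 in H end; subst b0 args0.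
have eb : b' = b.
  (* Keeping [b] captures nothing: [sigma] sends a renamed variable [f X] back to [X], which [b]
     does not bind in this argument. *)
  have /functional_extensionality : b' =1 b.
    apply: keep => i s Y si /(rename_fv _ (avoids_away _ av)) [X fvX ->].
    rewrite /away; case: (slot_ofP b i X) => [[t [ti bt ->]] [] | [nb ->] _].
      by exists t.
    rewrite inv; last by exists i.
    by move=> /= eX; apply: nb; exists s.
  case: b' {rep nocap keep und} => g ginj; case: b {IH av inv reps} => h hinj /= egh.
  by move: ginj; rewrite egh => ginj; rewrite (proof_irrelevance _ ginj hinj).
subst b'; congr Con; apply: functional_extensionality => i.
case: und => und_b und_f.
apply: (IH i _ _ _ (avoids_away _ av) _ (reps i)) => X fvX; rewrite /away.
case: (slot_ofP b i X) => [[s [si <- eqs]] | [nb ->]].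
  by rewrite eqs und_b.
rewrite und_f; last exact: avoids_bound av nb.
by apply: inv; exists i.
Qed.

End Denotation.

(** * Alpha-equivalence of values is preserved by contexts *)

Section Semantics.
Variables (V D : Type) (L : language V D).
Hypothesis large : sufficiently_large V (sig_of L).
Hypothesis postulate : alpha_postulate L.

Lemma den_esubst (E : term L) (sigma : substitution V (sig_of L)) e n :
  den (esubst E sigma) e n = den E (fun X => den (app sigma X) e) n.
Proof. exact: den_replaced (esubstP E sigma). Qed.

Lemma esubst_fv (E : term L) (sigma : substitution V (sig_of L)) (Y : V) :
  fv (esubst E sigma) Y <-> exists2 X, fv E X & fv (app sigma X) Y.
Proof. exact: replaced_fv (esubstP E sigma). Qed.

Lemma eq_den_alpha (E F : term L) :
  (forall e n, den E e n = den F e n) -> alpha E F.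
Proof.
apply: den_alpha large _ E F => sigma E.
exists (esubst E (fun X => Some (sigma X))).
exact: (esubstP E (fun X => Some (sigma X))).
Qed.

Lemma alpha_value_refl (v : value L) : alpha_value v v.
Proof. by case: postulate => refl _ _; apply: refl. Qed.

Lemma alpha_value_sym (v w : value L) : alpha_value v w -> alpha_value w v.
Proof. by case: postulate => _ sym _; apply: sym. Qed.

Lemma alpha_value_trans (u v w : value L) :
  alpha_value u v -> alpha_value v w -> alpha_value u w.
Proof. by case: postulate => _ _ trans; apply: trans. Qed.

Lemma alpha_sem (E F : term L) (rho : V -> value L) :
  alpha E F -> alpha_value (sem E rho) (sem F rho).
Proof. by move=> a; exists E, F, rho. Qed.

Lemma sem_esubst (E : term L) (sigma : substitution V (sig_of L))
    (rho : V -> value L) :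
  alpha_value (sem (esubst E sigma) rho)
              (sem E (fun X => sem (app sigma X) rho)).
Proof.
have [F a ->] := sem_subst E sigma rho; exact: alpha_sem.
Qed.

(* [E] is literally the result of substituting back in [rename f E], so the
   standing assumption on substitutions yields an equation here, not just an
   equivalence of values. *)
Lemma sem_rename (E : term L) (f : V -> V) (rho rho' : V -> value L) :
  avoids f (bv E) -> (forall X Y, fv E X -> fv E Y -> f X = f Y -> X = Y) ->
  (forall X, fv E X -> rho' (f X) = rho X) ->
  exists2 F : term L, alpha F (rename f E) & sem F rho' = sem E rho.
Proof.
move=> av finj rho_f.
have inj_sub : injective (fun x : {X | fv E X} => f (sval x)).
  by move=> x y /finj eq_xy; apply: sval_injective; apply: eq_xy; apply: svalP.
(* [g] inverts [f] on the free variables of [E]. *)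
have [g [gf _]] := extend_along
  (fun x : {X | fv E X} => Var (S := sig_of L) (sval x)) Var inj_sub.
have {}gf X : fv E X -> g (f X) = Var X by move=> fvX; apply: (gf (exist _ X fvX)).
have eE := replaced_rename av gf (esubstP (rename f E) (fun X => Some (g X))).
have [F a] := sem_subst (rename f E) (fun X => Some (g X)) rho.
rewrite eE => ->; exists F => //; apply: sem_fv => Y.
move=> /(alpha_fv _ a)/(rename_fv _ av) [X fvX ->].
by rewrite /app /= gf // sem_var rho_f.
Qed.

(* Infinitely many variables may matter to [E], so the terms witnessing the
   hypotheses are first renamed to share a single valuation. *)
Lemma alpha_value_sem (E : term L) (rho rho' : V -> value L) :
  (forall X, fv E X -> alpha_value (rho X) (rho' X)) ->
  alpha_value (sem E rho) (sem E rho').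
Proof.
move=> eq_rho.
have [w wP] : exists w : V -> term L * term L * (V -> value L), forall X, fv E X ->
    [/\ alpha (w X).1.1 (w X).1.2, sem (w X).1.1 (w X).2 = rho X
      & sem (w X).1.2 (w X).2 = rho' X].
  apply: (@fun_choice _ _ (fun X (w : term L * term L * (V -> value L)) => fv E X ->
    [/\ alpha w.1.1 w.1.2, sem w.1.1 w.2 = rho X & sem w.1.2 w.2 = rho' X])) => X.
  have [fvX | nfvX] := classic (fv E X); last by exists (Var X, Var X, rho).
  by have [A [B [z P]]] := eq_rho X fvX; exists (A, B, z).
pose A X := (w X).1.1; pose B X := (w X).1.2; pose z X := (w X).2.
(* Each free variable of each witness [A X] gets its own fresh name, so that the valuations [z X]
   can be merged into the single [r]. *)
pose I := {x : {X | fv E X} & {Y | fv (A (sval x)) Y}}.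
have smallE := small_fv large E.
have smallI : small V I.
  have [_ regular _ _] := large; apply: regular => // x; exact: small_fv large _.
pose W X := exists x : {X | fv E X}, bv (A (sval x)) X \/ bv (B (sval x)) X.
have smallW : small V {X | W X}.
  by apply: (small_bigcup large) => // x; apply: (small_setU large);
    apply: (small_bv large).
have [h hinj hfresh] := fresh_inj large smallI smallW.
pose pair (u : I) := (sval (projT1 u), sval (projT2 u)).
have pair_inj : injective pair.
  case=> [[X pX] [Y pY]] [[X' pX'] [Y' pY']] [/= eX eY]; subst X' Y'.
  by rewrite (proof_irrelevance _ pX' pX) in pY' *; rewrite (proof_irrelevance _ pY' pY).
have [f [fh f_or]] := extend_along h snd pair_inj.
have [r [rh _]] := extend_along (fun u => z (pair u).1 (pair u).2) rho hinj.
have fE X Y (pX : fv E X) (pY : fv (A X) Y) :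
    f (X, Y) = h (existT _ (exist _ X pX) (exist _ Y pY) : I).
  exact: fh (existT _ (exist _ X pX) (exist _ Y pY) : I).
have f_av X Q : fv E X -> (forall Y, bv Q Y -> bv (A X) Y \/ bv (B X) Y) ->
    avoids (fun Y => f (X, Y)) (bv Q).
  move=> fvX QW Y; case: (f_or (X, Y)) => [-> | [u ->]]; first by left.
  by right=> /QW bvu; apply: (hfresh u); exists (exist _ X fvX).
have f_inj X : fv E X -> forall Y Y', fv (A X) Y -> fv (A X) Y' ->
    f (X, Y) = f (X, Y') -> Y = Y'.
  by move=> pX Y Y' pY pY'; rewrite !fE => /hinj/(congr1 pair) [].
have f_r X : fv E X -> forall Y, fv (A X) Y -> r (f (X, Y)) = z X Y.
  by move=> pX Y pY; rewrite fE rh.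
have [s sP] : exists s : V -> term L * term L, forall X, fv E X ->
    [/\ alpha (s X).1 (s X).2, sem (s X).1 r = rho X & sem (s X).2 r = rho' X].
  apply: (@fun_choice _ _ (fun X (s : term L * term L) => fv E X ->
    [/\ alpha s.1 s.2, sem s.1 r = rho X & sem s.2 r = rho' X])) => X.
  have [pX | nfvX] := classic (fv E X); last by exists (Var X, Var X).
  have [aAB semA semB] := wP X pX.
  have avA : avoids (fun Y => f (X, Y)) (bv (A X)) by apply: f_av => // Y; left.
  have avB : avoids (fun Y => f (X, Y)) (bv (B X)) by apply: f_av => // Y; right.
  (* Alpha-convertible terms share their free variables, so the renaming and valuation built from
     [A X] also serve [B X]. *)
  have BA Y : fv (B X) Y -> fv (A X) Y by move/(alpha_fv Y aAB).
  have [F aF semF] := sem_rename avA (f_inj X pX) (f_r X pX).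
  have [G aG semG] := sem_rename avB
    (fun Y Y' p p' => f_inj X pX Y Y' (BA Y p) (BA Y' p'))
    (fun Y p => f_r X pX Y (BA Y p)).
  exists (F, G) => _ /=; rewrite semF semG; split=> //.
  apply: eq_den_alpha => e n.
  by rewrite (alpha_den _ _ aF) (alpha_den _ _ aG) !den_rename // (alpha_den _ _ aAB).
(* Both values now come from substitution instances of [E] under [r], and these instances are
   alpha-convertible. *)
have -> : sem E rho = sem E (fun X => sem (app (fun X => Some (s X).1) X) r).
  by apply: sem_fv => X /sP [_ <-].
have -> : sem E rho' = sem E (fun X => sem (app (fun X => Some (s X).2) X) r).
  by apply: sem_fv => X /sP [_ _ <-].
apply: alpha_value_trans (alpha_value_sym (sem_esubst _ _ _)) _.
apply: alpha_value_trans (sem_esubst _ _ _).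
apply: alpha_sem; apply: eq_den_alpha => e n; rewrite !den_esubst.
by apply: eq_den => X /sP [a _ _] m; apply: alpha_den.
Qed.

End Semantics.

(** * Free variables of translated terms *)

Section Translation.
Variables (V D : Type) (L L' : language V D) (T : term L -> term L').
Hypothesis large : sufficiently_large V (sig_of L).
Hypothesis comp : compositional T.

(** Compositionality speaks only of substitutions whose domain is exactly [fv E]. *)
Definition restrict (E : term L) (g : V -> term L) : substitution V (sig_of L) :=
  fun X => if excluded_middle_informative (fv E X) then Some (g X) else None.

Lemma restrict_in (E : term L) (g : V -> term L) (X : V) :
  fv E X -> restrict E g X = Some (g X).
Proof. by rewrite /restrict; case: excluded_middle_informative. Qed.

Lemma restrict_out (E : term L) (g : V -> term L) (X : V) :
  ~ fv E X -> restrict E g X = None.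
Proof. by rewrite /restrict; case: excluded_middle_informative. Qed.

Lemma dom_restrict (E : term L) (g : V -> term L) (X : V) :
  dom (restrict E g) X <-> fv E X.
Proof. by rewrite /dom /restrict; case: excluded_middle_informative. Qed.

Lemma den_restrict (E : term L) (g : V -> term L) e n :
  den (esubst E (restrict E g)) e n = den E (fun X => den (g X) e) n.
Proof.
rewrite den_esubst; apply: eq_den => X fvX m.
by rewrite /app restrict_in.
Qed.

Lemma restrict_fv (E : term L) (g : V -> term L) (Y : V) :
  fv (esubst E (restrict E g)) Y <-> exists2 X, fv E X & fv (g X) Y.
Proof.
rewrite esubst_fv; split=> -[X fvX fvY]; exists X => //;
  by move: fvY; rewrite /app restrict_in.
Qed.

Lemma trans_restrict (E : term L) (g : V -> term L) :
  alpha (T (esubst E (restrict E g)))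
        (esubst (T E) (fun X => omap T (restrict E g X))).
Proof. by case: comp => compT _ _; apply: compT => X; apply: dom_restrict. Qed.

Lemma trans_restrict_fv (E : term L) (g : V -> term L) (X Y : V) :
  fv E X -> fv (T E) X -> fv (T (g X)) Y -> fv (T (esubst E (restrict E g))) Y.
Proof.
move=> fvX fvTX fvY; rewrite (alpha_fv _ (trans_restrict E g)) esubst_fv.
by exists X => //; rewrite /app restrict_in.
Qed.

(* Renaming a free variable of [E] into [Z] and back yields [E] again, but
   the second substitution removes [Z] from the translation. *)
Lemma trans_fv (E : term L) (X Z : V) : fv E X -> fv (T E) Z -> fv E Z.
Proof.
move=> fvX fvTZ; apply: NNPP => nfvZ.
have [_ alphaT TVar] := comp.
pose swap (A B Y : V) : term L :=
  if excluded_middle_informative (Y = A) then Var B else Var Y.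
have swapE A B : swap A B A = Var B.
  by rewrite /swap; case: excluded_middle_informative.
have swapN A B Y : Y <> A -> swap A B Y = Var Y.
  by rewrite /swap; case: excluded_middle_informative.
have XZ : X <> Z by move=> eXZ; apply: nfvZ; rewrite -eXZ.
set E' := esubst E (restrict E (swap X Z)).
have fvZ : fv E' Z by apply/restrict_fv; exists X; rewrite ?swapE.
have back : alpha E (esubst E' (restrict E' (swap Z X))).
  apply: (eq_den_alpha large) => e n; rewrite den_restrict den_restrict.
  apply: eq_den => Y fvY m.
  have [-> | YX] := classic (Y = X); first by rewrite swapE /= swapE.
  by rewrite swapN //= swapN // => eYZ; apply: nfvZ; rewrite -eYZ.
move: fvTZ; rewrite (alpha_fv _ (alphaT _ _ back)).
rewrite (alpha_fv _ (trans_restrict _ _)) esubst_fv => -[Y _].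
(* The second substitution turns [Z] into [X] and fixes all other variables, so nothing yields
   [Z]. *)
rewrite /app; have [YZ | YZ] := classic (Y = Z).
  by rewrite YZ restrict_in //= swapE TVar /= => /esym.
have [fvY | nfvY] := classic (fv E' Y).
  by rewrite restrict_in //= swapN // TVar /= => /esym.
by rewrite restrict_out //= => /esym.
Qed.

(* Substitute [P] for [Y] in [E], and a variable other than [Z] for the rest. *)
Lemma trans_fv_unique (P E : term L) (X Y Z : V) :
  Defs.closed P -> fv (T P) Z -> fv E X -> fv E Y -> fv (T E) Y -> X = Y.
Proof.
move=> closedP fvPZ fvX fvY fvTY; apply: NNPP => XY.
have [Z' ZZ'] : exists Z', Z' <> Z.
  have [XZ | ] := classic (X = Z); last by exists X.
  by exists Y => YZ; apply: XY; rewrite XZ YZ.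
pose g U := if excluded_middle_informative (U = Y) then P else Var Z'.
have gY : g Y = P by rewrite /g; case: excluded_middle_informative.
have gN U : U <> Y -> g U = Var Z'.
  by rewrite /g; case: excluded_middle_informative.
have fvZ' : fv (esubst E (restrict E g)) Z'.
  by apply/restrict_fv; exists X; rewrite ?gN.
(* The translated instance contains [Z] through [T P]. The instance itself is open because of [Z'],
   so [trans_fv] makes [Z] free in it, yet only [Z'] can be free there. *)
have : fv (esubst E (restrict E g)) Z.
  by apply: trans_fv fvZ' _; apply: trans_restrict_fv fvY fvTY _; rewrite gY.
case/restrict_fv => U _; have [-> | /gN ->] := classic (U = Y).
  by rewrite gY => /closedP.
by move=> /= /esym.
Qed.

End Translation.

(** * Construction of the semantic translation *)

Theorem theorem7 (V D : Type) (L L' : language V D) (le : D -> D -> Prop)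
    (T : term L -> term L') :
  sufficiently_large V (sig_of L) ->
  sufficiently_large V (sig_of L') ->
  alpha_postulate L ->
  alpha_postulate L' ->
  PreOrder le ->
  respects_alpha le L ->
  respects_alpha le L' ->
  (forall v : value L, exists P : term L, denotes P v) ->
  compositional T ->
  respects le T ->
  valid_up_to le T.
Proof.
move=> large large' post post' [_ le_trans] le_alpha le_alpha' denotable comp.
move=> [lowerU le_T].
pose R (v' : value L') (v : value L) := exists P w (eta : V -> value L'),
  [/\ denotes P w, alpha_value w v, forall X, in_U L le (eta X)
    & alpha_value v' (sem (T P) eta)].
have R_le v' v : R v' v -> le (sval v') (sval v).
  move=> [P [w [eta [Pw wv etaU v'T]]]].
  apply: (le_trans _ _ _ (le_alpha' _ _ v'T)).
  by apply: (le_trans _ _ _ _ (le_alpha _ _ wv)); apply: le_T.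
exists R; split=> // [v | E eta rho etaR].
  have [P Pv] := denotable v; have [u u_le] := lowerU v.
  exists (sem (T P) (fun=> u)), P, v, (fun=> u).
  by split=> // [|X|]; [exact: alpha_value_refl | exists v | exact: alpha_value_refl].
have etaU X : in_U L le (eta X) by exists (rho X); apply: R_le.
have [[X0 fvX0] | closedE] := classic (exists X, fv E X); last first.
  (* A closed [E] is its own witness. *)
  exists E, (sem E rho), eta; split=> //; try exact: alpha_value_refl.
  by split=> [X fvX | r]; [|apply: sem_fv => X fvX]; case: closedE; exists X.
have [w wP] : exists w : V -> term L * value L * (V -> value L'), forall X,
    [/\ denotes (w X).1.1 (w X).1.2, alpha_value (w X).1.2 (rho X),
        forall Y, in_U L le ((w X).2 Y)
      & alpha_value (eta X) (sem (T (w X).1.1) (w X).2)].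
  apply: (@fun_choice _ _ (fun X (w : term L * value L * (V -> value L')) =>
    [/\ denotes w.1.1 w.1.2, alpha_value w.1.2 (rho X),
        forall Y, in_U L le (w.2 Y) & alpha_value (eta X) (sem (T w.1.1) w.2)])) => X.
  by have [P [v [z H]]] := etaR X; exists (P, v, z).
pose P X := (w X).1.1.
have closedP X : Defs.closed (P X) by have [[]] := wP X.
have [z zU zP] : exists2 z : V -> value L', forall Y, in_U L le (z Y) &
    forall X, fv (T E) X -> sem (T (P X)) (w X).2 = sem (T (P X)) z.
  (* If [T E] is closed, any of the valuations will do. Otherwise take the one at a free variable
     [X] of [T E]: a free variable in [T (P Y)], for [Y] free in [T E], would force [Y = X], so for
     [Y] other than [X] the valuation is irrelevant. *)
  have [[X fvTX] | closedTE] := classic (exists X, fv (T E) X); last first.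
    by exists (w X0).2 => [|X fvX]; [case: (wP X0) | case: closedTE; exists X].
  exists (w X).2 => [|Y fvTY]; first by case: (wP X).
  apply: sem_fv => Z fvZ; suff -> : Y = X by [].
  apply: (trans_fv_unique large comp (closedP Y) fvZ _ _ fvTX);
    exact: (trans_fv large comp fvX0).
set Q := esubst E (restrict E P).
have closedQ : Defs.closed Q by move=> Y /restrict_fv [X _ /closedP].
(* As [Q] is closed, [sem Q rho] is its value under every valuation. Both equivalences follow by
   pulling the substitution into the valuation, in [L] for [Q] and, by compositionality, in [L'] for
   [T Q]. *)
exists Q, (sem Q rho), z; split=> //.
- by split=> // r; apply: sem_fv => X /closedQ.
- apply: (alpha_value_trans post (sem_esubst _ _ _)).
  apply: alpha_value_sem => // X fvX; rewrite /app restrict_in //=.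
  by have [[_ ->]] := wP X.
- apply: alpha_value_sym => //.
  apply: (alpha_value_trans post' (alpha_sem _ (trans_restrict comp _ _))).
  apply: (alpha_value_trans post' (sem_esubst _ _ _)).
  apply: alpha_value_sem => // X fvX.
  rewrite /app restrict_in /=; last exact: (trans_fv large comp fvX0).
  by rewrite -zP //; apply: alpha_value_sym => //; case: (wP X).
Qed.
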